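(* Let $\varphi$ be a holomorphic self-map of $\mathbb{B}_N$ such that the composition operator $C_\varphi$ is bounded on $\mathcal{D}(\mathbb{B}_N)$. Then $C_\varphi$ is $J$-symmetric on $\mathcal{D}(\mathbb{B}_N)$ if and only if $\varphi(z)=\varphi'(0)z$ for all $z\in\mathbb{B}_N$ and $\varphi'(0)$ is a symmetric matrix with $\|\varphi'(0)\|\le 1$.
   Context: $\mathbb{B}_N$ is the open unit ball of $\mathbb{C}^N$ and $\langle\cdot,\cdot\rangle$ is the Euclidean inner product on $\mathbb{C}^N$ (linear in the first variable). $\mathcal{D}(\mathbb{B}_N)$ (the Dirichlet space) is the Hilbert space of holomorphic functions on $\mathbb{B}_N$ with reproducing kernel $K_w(z)=1+\ln\frac{1}{1-\langle z,w\rangle}$, i.e. $f(w)=\langle f,K_w\rangle$ for all $f\in\mathcal{D}(\mathbb{B}_N)$, $w\in\mathbb{B}_N$. $C_\varphi f=f\circ\varphi$. $J$ is the conjugation $(Jf)(z)=\overline{f(\overline{z})}$, where $\overline z$ is the coordinatewise conjugate. A bounded operator $T$ is $J$-symmetric if $TJ=JT^*$. $\varphi'(0)$ is the $N\times N$ complex Jacobian matrix of $\varphi$ at $0$; ''symmetric'' means equal to its transpose; $\|\cdot\|$ is the operator norm on $\mathbb{C}^N$. *)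

(* Defs.v *)
From HB Require Import structures.
From mathcomp Require Import all_boot all_order all_algebra complex.
From mathcomp Require Import all_classical all_reals all_analysis.
Set Implicit Arguments.
Unset Strict Implicit.
Unset Printing Implicit Defensive.
Import Order.TTheory GRing.Theory Num.Theory.
Import ComplexField.Normc.
Import numFieldNormedType.Exports.
Local Open Scope classical_set_scope.
Local Open Scope ring_scope.

(* The usual topology of R[i], by the same construction as that of
   numFieldNormedType. *)
#[non_forgetful_inheritance]
HB.instance Definition _ (R : realType) := NormedModule.copy R[i] R[i]^o.

Section ComplexLog.
Variable R : realType.
Implicit Type z : R[i].

(* Principal argument, with values in ]-pi, pi] for z != 0. *)
Definition carg z : R :=
  if 0 <= complex.Im z then acos (complex.Re z / normc z)
  else - acos (complex.Re z / normc z).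

Definition clog z : R[i] := Complex (ln (normc z)) (carg z).

End ComplexLog.

Section Euclidean.
Variables (R : realType) (N : nat).
Implicit Types (z w : 'cV[R[i]]_N) (A : 'M[R[i]]_N).

Definition dotc z w : R[i] := \sum_i z i 0 * conjc (w i 0).

(* The library norm on 'cV[R[i]]_N is the max norm; it induces the same
   topology, hence the same notion of differentiability, but not the same
   unit ball. *)
Definition enorm z : R := Num.sqrt (complex.Re (dotc z z)).

Definition opnorm A : R :=
  sup [set enorm (A *m z) | z in [set z | enorm z <= 1]].

Definition unit_ball : Type := {z : 'cV[R[i]]_N | enorm z < 1}.
HB.instance Definition _ := SubType.on unit_ball.

Lemma enorm_conj z : enorm (map_mx conjc z) = enorm z.
Proof.
rewrite /enorm /dotc; congr (Num.sqrt (complex.Re _)).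
by apply: eq_bigr => i _; rewrite !mxE conjcK mulrC.
Qed.

Lemma enorm_conj_lt1 (z : unit_ball) : enorm (map_mx conjc (val z)) < 1.
Proof. by rewrite enorm_conj; exact: (valP z). Qed.

Definition conj_ball (z : unit_ball) : unit_ball :=
  Sub (map_mx conjc (val z)) (enorm_conj_lt1 z).

(* Differentiability is a notion on total functions: functions on the ball are
   extended by 0. The ball being open, the derivatives at its points do not
   depend on the extension. *)
Definition extend (V : zmodType) (f : unit_ball -> V) (z : 'cV[R[i]]_N) : V :=
  oapp f 0 (insub z).

Definition holomorphic (V : normedModType R[i]) (f : unit_ball -> V) : Prop :=
  forall z : unit_ball, differentiable (extend f) (val z).

(* Complex Jacobian matrix at 0, with entries d phi_i / d z_j. *)
Definition jacobian0 (phi : unit_ball -> unit_ball) : 'M[R[i]]_N :=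
  \matrix_(i, j)
    ('D_(delta_mx j 0) (extend (fun z : unit_ball => val (phi z))) (0 : 'cV[R[i]]_N)) i 0.

End Euclidean.

Section Hilbert.
Variables (R : realType) (V : lmodType R[i]).
(* The Hilbert space is the subset H of V; ip is only meaningful on H. *)
Variables (H : set V) (ip : V -> V -> R[i]).

Definition hnorm (f : V) : R := Num.sqrt (complex.Re (ip f f)).

Record is_hilbert_space : Prop := {
  hilbert0 : H 0;
  hilbertP : forall (a : R[i]) f g, H f -> H g -> H (a *: f + g);
  ip_linear : forall (a : R[i]) f g h, H f -> H g -> H h ->
    ip (a *: f + g) h = a * ip f h + ip g h;
  ip_herm : forall f g, H f -> H g -> ip g f = conjc (ip f g);
  ip_ge0 : forall f, H f -> 0 <= ip f f;
  ip_eq0 : forall f, H f -> ip f f = 0 -> f = 0;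
  hilbert_complete : forall u : nat -> V, (forall k, H (u k)) ->
    (forall e : R, 0 < e -> exists M : nat, forall k l : nat,
      (M <= k)%N -> (M <= l)%N -> hnorm (u k - u l) < e) ->
    exists2 f, H f & hnorm (u k - f) @[k --> \oo] --> (0 : R)
}.

Definition bounded_operator (T : V -> V) : Prop :=
  [/\ forall f, H f -> H (T f),
      forall (a : R[i]) f g, H f -> H g -> T (a *: f + g) = a *: T f + T g
    & exists M : R, forall f, H f -> hnorm (T f) <= M * hnorm f].

Definition is_adjoint (T S : V -> V) : Prop :=
  bounded_operator S /\ forall f g, H f -> H g -> ip (T f) g = ip f (S g).

(* The adjoint of T is unique on H, and exists when T is bounded. *)
Definition conj_symmetric (J T : V -> V) : Prop :=
  exists2 S, is_adjoint T S & forall f, H f -> T (J f) = J (S f).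

End Hilbert.

Section Dirichlet.
Variables (R : realType) (N : nat).

Definition ball_fun : Type := unit_ball R N -> R[i]^o.
HB.instance Definition _ := GRing.Lmodule.on ball_fun.

Definition dirichlet_kernel (w : unit_ball R N) : ball_fun :=
  fun z => 1 + clog (1 / (1 - dotc (val z) (val w))).

(* A reproducing kernel determines its Hilbert space of functions, so D and ip
   are unique (ip up to its values outside of D). *)
Record is_dirichlet_space (D : set ball_fun) (ip : ball_fun -> ball_fun -> R[i])
    : Prop := {
  dirichlet_hilbert : is_hilbert_space D ip;
  dirichlet_holomorphic : forall f, D f -> holomorphic f;
  dirichlet_kernelP : forall w, D (dirichlet_kernel w);
  dirichlet_reproducing : forall f w, D f -> f w = ip f (dirichlet_kernel w)
}.

Definition composition_operator (phi : unit_ball R N -> unit_ball R N)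
  (f : ball_fun) : ball_fun := fun z => f (phi z).

Definition conjJ (f : ball_fun) : ball_fun := fun z => conjc (f (conj_ball z)).

End Dirichlet.

(* Main.v *)
Require Import Defs.
From HB Require Import structures.
From mathcomp Require Import all_boot all_order all_algebra complex.
From mathcomp Require Import all_classical all_reals all_analysis.
From mathcomp Require Import ring lra.
Set Implicit Arguments.
Unset Strict Implicit.
Unset Printing Implicit Defensive.
Import Order.TTheory GRing.Theory Num.Theory.
Import ComplexField.Normc.
Import numFieldNormedType.Exports.
Local Open Scope classical_set_scope.
Local Open Scope ring_scope.

(* The adjoint of [C_phi] maps [K_w] to [K_(phi w)], and [J] maps [K_w] to
   [K_(conj w)], so on kernels J-symmetry says
   [K_(conj w) (phi z) = K_(conj (phi w)) z]. The logarithm being injective on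
   the values involved, this is [phi(z)^T w = z^T phi(w)]; evaluating it at
   multiples of basis vectors shows that [phi] is a symmetric matrix.
   Conversely, the kernels span a dense subspace of the Dirichlet space, whence
   [J] is antiunitary on it and [S = J C_phi J] is the adjoint of [C_phi]. *)

(** * The principal logarithm: injectivity and compatibility with conjugation *)

Section ComplexFacts.
Variable R : realType.
Implicit Types (z a b s : R[i]).

Lemma sqr_normcE z :
  normc z ^+ 2 = complex.Re z ^+ 2 + complex.Im z ^+ 2.
Proof. by case: z => x y; rewrite /normc sqr_sqrtr // addr_ge0 ?sqr_ge0. Qed.

Lemma normc_ge0 z : 0 <= normc z.
Proof. by case: z => x y; exact: sqrtr_ge0. Qed.

Lemma normc_conj z : normc (conjc z) = normc z.
Proof. by case: z => x y; rewrite /normc /= sqrrN. Qed.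

Lemma normc_eq0_le a b : normc (a - b) <= 0 -> a = b.
Proof.
move=> h; apply/eqP; rewrite -subr_eq0; apply/eqP/eq0_normc/eqP.
by rewrite eq_le h normc_ge0.
Qed.

Lemma normc_gt0 z : z != 0 -> 0 < normc z.
Proof.
move=> z0; rewrite lt_neqAle normc_ge0 andbT eq_sym.
by apply: contra z0 => /eqP/eq0_normc ->.
Qed.

Lemma Re_div_normc_bounds z : z != 0 -> -1 <= complex.Re z / normc z <= 1.
Proof.
move=> /normc_gt0 z0; rewrite -ler_norml normrM normfV (gtr0_norm z0).
rewrite ler_pdivrMr // mul1r -ler_sqr ?nnegrE ?normc_ge0 //.
by rewrite sqr_normcE -normrX ger0_norm ?sqr_ge0 // lerDl sqr_ge0.
Qed.

(** [acos] recovers the real part from the argument and the modulus, and the modulus then gives the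
    imaginary part up to sign. The sign is settled by the branch of [carg]. *)
Lemma carg_inj a b : a != 0 -> b != 0 -> normc a = normc b ->
  carg a = carg b -> a = b.
Proof.
move=> a0 b0 nab.
have [Ba Bb] := (Re_div_normc_bounds a0, Re_div_normc_bounds b0).
have acos_inj (x y : R) : -1 <= x <= 1 -> -1 <= y <= 1 ->
    acos x = acos y -> x = y.
  by move=> hx hy e; rewrite -(acosK (x:=x)) ?in_itv // e acosK ?in_itv.
(* The two branches of [carg] take values of opposite sign, so they can only agree at 0. That would
   make [w] a positive real, against [Im w < 0]. *)
have opp_sign z w : z != 0 -> w != 0 -> 0 <= complex.Im z ->
    complex.Im w < 0 -> carg z <> carg w.
  move=> z0 w0 hz hw; rewrite /carg hz leNgt hw /= => e.
  have [Bz Bw] := (Re_div_normc_bounds z0, Re_div_normc_bounds w0).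
  have : acos (complex.Re w / normc w) = 0.
    apply/eqP; rewrite eq_le (acos_ge0 Bw) andbT -oppr_ge0 -e.
    exact: acos_ge0.
  rewrite -(@acos1 R) => /(acos_inj _ _ Bw) h1.
  have {}h1 : complex.Re w / normc w = 1 by apply: h1; lra.
  have rw : complex.Re w = normc w.
    by rewrite -[RHS]mul1r -h1 divfK // gt_eqF // normc_gt0.
  have := sqr_normcE w; rewrite -rw -[LHS]addr0 => /addrI/esym/eqP.
  by rewrite sqrf_eq0 => /eqP h; move: hw; rewrite h ltxx.
move=> e.
have signs : (0 <= complex.Im a) = (0 <= complex.Im b).
  case: (leP 0 (complex.Im a)) => ha; case: (leP 0 (complex.Im b)) => hb //.
  - by have := opp_sign _ _ a0 b0 ha hb e.
  - by have := opp_sign _ _ b0 a0 hb ha (esym e).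
have er : complex.Re a = complex.Re b.
  move: e; rewrite /carg -signs => e.
  have {}e : acos (complex.Re a / normc a) = acos (complex.Re b / normc b).
    by move: e; case: ifP => _ // /oppr_inj.
  move: (acos_inj _ _ Ba Bb e); rewrite nab => /mulIf; apply.
  by rewrite invr_eq0 gt_eqF // normc_gt0.
have : complex.Im a ^+ 2 = complex.Im b ^+ 2.
  by apply: (addrI (complex.Re a ^+ 2)); rewrite -sqr_normcE nab er sqr_normcE.
move/eqP; rewrite eqf_sqr => /orP[]/eqP ei.
  by move: er ei; case: (a) => ? ?; case: (b) => ? ? /= -> ->.
have b0' : complex.Im b = 0.
  by move: signs; rewrite ei; case: (ltgtP 0 (complex.Im b)); lra.
move: er ei; rewrite b0' oppr0; move: b0'.
by case: (a) => ? ?; case: (b) => ? ? /= -> -> ->.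
Qed.

Lemma clog_inj a b : a != 0 -> b != 0 -> clog a = clog b -> a = b.
Proof.
move=> a0 b0 [el ea]; apply: carg_inj => //.
by apply: ln_inj => //; rewrite posrE normc_gt0.
Qed.

(** A positive real part keeps [a] off the negative real axis, where [carg] is pi both at [a] and at
    its conjugate and the identity fails. *)
Lemma clog_conj a : 0 < complex.Re a -> clog (conjc a) = conjc (clog a).
Proof.
move=> ra; rewrite /clog normc_conj; congr (Complex _ _).
rewrite /carg normc_conj.
case: a ra => x y /= x0; rewrite oppr_ge0.
case: ltgtP => [y0|y0|->] //; first by rewrite opprK.
rewrite expr0n /= addr0 sqrtr_sqr gtr0_norm // divff ?gt_eqF //.
by rewrite acos1 oppr0.
Qed.

Lemma Re_inv_gt0 a : 0 < complex.Re a -> 0 < complex.Re a^-1.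
Proof.
case: a => x y /= x0; rewrite divr_gt0 //.
by rewrite ltr_pwDl ?sqr_ge0 // exprn_gt0.
Qed.

Lemma Re_gt0_neq0 a : 0 < complex.Re a -> a != 0.
Proof. by apply: contraTneq => ->; rewrite ltxx. Qed.

Lemma ReD a b : complex.Re (a + b) = complex.Re a + complex.Re b.
Proof. by case: a; case: b. Qed.

Lemma ReB a b : complex.Re (a - b) = complex.Re a - complex.Re b.
Proof. by case: a; case: b. Qed.

Lemma Re_conjc a : complex.Re (conjc a) = complex.Re a.
Proof. by case: a. Qed.

Lemma clog_inv1B_inj a b : complex.Re a < 1 -> complex.Re b < 1 ->
  clog (1 / (1 - a)) = clog (1 / (1 - b)) -> a = b.
Proof.
move=> a1 b1; rewrite !mul1r => /clog_inj e.
apply: oppr_inj; apply: (addrI 1); apply: invr_inj.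
apply: e; rewrite invr_eq0; apply: Re_gt0_neq0; rewrite ReB subr_gt0 //.
Qed.

Lemma clog_inv1B_conj a : complex.Re a < 1 ->
  conjc (1 + clog (1 / (1 - a))) = 1 + clog (1 / (1 - conjc a)).
Proof.
move=> a1; rewrite rmorphD rmorph1; congr (1 + _).
rewrite -[LHS]clog_conj ?rmorphM ?fmorphV ?rmorphB ?rmorph1 //.
by rewrite mul1r Re_inv_gt0 // ReB subr_gt0.
Qed.

End ComplexFacts.

(** * The Euclidean inner product, its unit ball and the operator norm *)

Section EuclideanFacts.
Variables (R : realType) (N : nat).
Implicit Types (z w : 'cV[R[i]]_N) (A : 'M[R[i]]_N).

Lemma dotc_conj z w :
  dotc (map_mx conjc z) w = conjc (dotc z (map_mx conjc w)).
Proof.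
rewrite /dotc rmorph_sum; apply: eq_bigr => i _.
by rewrite rmorphM !mxE /= conjcK.
Qed.

Lemma dotc_herm z w : dotc w z = conjc (dotc z w).
Proof.
rewrite /dotc rmorph_sum; apply: eq_bigr => i _.
by rewrite rmorphM /= conjcK mulrC.
Qed.

Lemma dotcE z w : dotc z (map_mx conjc w) = (z^T *m w) 0 0.
Proof. by rewrite /dotc mxE; apply: eq_bigr => i _; rewrite !mxE conjcK. Qed.

Lemma Re_dotc_ge0 z : 0 <= complex.Re (dotc z z).
Proof.
rewrite /dotc raddf_sum sumr_ge0 // => i _.
by case: (z i 0) => x y /=; rewrite mulrN opprK addr_ge0 // -expr2 sqr_ge0.
Qed.

Lemma enorm_lt1 z : (enorm z < 1) = (complex.Re (dotc z z) < 1).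
Proof. by rewrite /enorm -{1}(sqrtr1 R) ltr_sqrt // ltr01. Qed.

(** Expanding [0 <= |z - w|^2] gives [2 Re <z, w> <= |z|^2 + |w|^2 < 2]. Hence [1 - <z, w>] has
    positive real part, which is what the logarithm lemmas require. *)
Lemma Re_dotc_lt1 z w : enorm z < 1 -> enorm w < 1 ->
  complex.Re (dotc z w) < 1.
Proof.
rewrite !enorm_lt1 => hz hw.
have := Re_dotc_ge0 (z - w).
have -> : dotc (z - w) (z - w) = dotc z z + dotc w w - dotc z w - dotc w z.
  rewrite /dotc -big_split -!sumrB; apply: eq_bigr => i _.
  by rewrite !mxE rmorphB /=; ring.
rewrite (dotc_herm z w) !ReB ReD Re_conjc.
lra.
Qed.

Lemma enormZ (t : R[i]) z : enorm (t *: z) = normc t * enorm z.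
Proof.
rewrite /enorm.
have -> : dotc (t *: z) (t *: z) = (normc t ^+ 2)%:C%C * dotc z z.
  rewrite /dotc mulr_sumr; apply: eq_bigr => i _; rewrite !mxE rmorphM /=.
  have -> : (normc t ^+ 2)%:C%C = t * conjc t.
    by rewrite sqr_normcE; case: (t) => x y; simpc; congr Complex; ring.
  ring.
have -> : complex.Re ((normc t ^+ 2)%:C%C * dotc z z) =
    normc t ^+ 2 * complex.Re (dotc z z).
  by case: (dotc z z) => x y /=; rewrite mul0r subr0.
by rewrite sqrtrM ?sqr_ge0 // sqrtr_sqr ger0_norm ?normc_ge0.
Qed.

Lemma enorm_delta j : enorm (delta_mx j 0 : 'cV[R[i]]_N) = 1.
Proof.
rewrite /enorm /dotc (bigD1 j) //= big1 ?addr0 => [|i ij].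
  by rewrite mxE !eqxx /= mulr1 mul0r subr0 sqrtr1.
by rewrite mxE (negPf ij) mul0r.
Qed.

(** If [|z| <= 1] and [n = |A z| > 1], then [z / n] lies in the open ball while its image has norm
    exactly 1. *)
Lemma opnorm_le1 A :
  (forall z, enorm z < 1 -> enorm (A *m z) < 1) -> opnorm A <= 1.
Proof.
move=> hA; apply: ge_sup.
  exists (enorm (A *m 0)), 0 => //=.
  by rewrite -(scale0r 0) enormZ normc0 mul0r.
move=> _ [z /= z1 <-]; rewrite leNgt; apply/negP => Az.
pose n := enorm (A *m z); have n0 : 0 < n := lt_trans ltr01 Az.
have nt : normc (n^-1)%:C%C = n^-1.
  by rewrite /normc /= expr0n /= addr0 sqrtr_sqr ger0_norm // invr_ge0 ltW.
have : enorm (A *m ((n^-1)%:C%C *: z)) < 1.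
  apply: hA; rewrite enormZ nt.
  have n1 : n^-1 < 1 by rewrite invf_lt1.
  by rewrite (le_lt_trans _ n1) // ler_piMr // invr_ge0 ltW.
by rewrite -scalemxAr enormZ nt mulVf ?gt_eqF // ltxx.
Qed.

End EuclideanFacts.

(** * Elementary Hilbert space geometry *)

Section HilbertFacts.
Variables (R : realType) (V : lmodType R[i]).
Variables (H : set V) (ip : V -> V -> R[i]).
Hypothesis hH : is_hilbert_space H ip.
Local Notation nrm := (hnorm ip).
Implicit Types f g h : V.

Lemma hilbertZ (a : R[i]) f : H f -> H (a *: f).
Proof. by move=> Hf; rewrite -[_ *: _]addr0; exact: (hilbertP hH _ Hf (hilbert0 hH)). Qed.

Lemma hilbertB f g : H f -> H g -> H (f - g).
Proof. by move=> Hf Hg; rewrite addrC -scaleN1r; exact: (hilbertP hH). Qed.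

Lemma hilbertD f g : H f -> H g -> H (f + g).
Proof. by move=> Hf Hg; rewrite -[f]scale1r; exact: (hilbertP hH). Qed.

Lemma ip0l h : H h -> ip 0 h = 0.
Proof.
move=> Hh; have := ip_linear hH 1 (hilbert0 hH) (hilbert0 hH) Hh.
by rewrite scaler0 addr0 mul1r -[LHS]addr0 => /addrI.
Qed.

Lemma ipZl (a : R[i]) f h : H f -> H h -> ip (a *: f) h = a * ip f h.
Proof.
move=> Hf Hh; rewrite -[_ *: _]addr0 (ip_linear hH) ?ip0l ?addr0 //.
exact: hilbert0 hH.
Qed.

Lemma ipDl f g h : H f -> H g -> H h -> ip (f + g) h = ip f h + ip g h.
Proof. by move=> Hf Hg Hh; rewrite -{1}[f]scale1r (ip_linear hH) // mul1r. Qed.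

Lemma ipBl f g h : H f -> H g -> H h -> ip (f - g) h = ip f h - ip g h.
Proof.
move=> Hf Hg Hh; rewrite addrC -scaleN1r (ip_linear hH) //.
by rewrite mulN1r addrC.
Qed.

Lemma ipZr (a : R[i]) f h : H f -> H h -> ip h (a *: f) = conjc a * ip h f.
Proof.
move=> Hf Hh; rewrite (ip_herm hH (hilbertZ a Hf) Hh) ipZl // rmorphM /=.
by rewrite -(ip_herm hH Hf Hh).
Qed.

Lemma ipDr f g h : H f -> H g -> H h -> ip h (f + g) = ip h f + ip h g.
Proof.
move=> Hf Hg Hh; rewrite (ip_herm hH (hilbertD Hf Hg) Hh) ipDl // rmorphD /=.
by rewrite -(ip_herm hH Hf Hh) -(ip_herm hH Hg Hh).
Qed.

Lemma ipBr f g h : H f -> H g -> H h -> ip h (f - g) = ip h f - ip h g.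
Proof.
move=> Hf Hg Hh; rewrite (ip_herm hH (hilbertB Hf Hg) Hh) ipBl // rmorphB /=.
by rewrite -(ip_herm hH Hf Hh) -(ip_herm hH Hg Hh).
Qed.

Lemma hnorm_ge0 f : 0 <= nrm f.
Proof. exact: sqrtr_ge0. Qed.

Lemma hnorm_sqr f : H f -> nrm f ^+ 2 = complex.Re (ip f f).
Proof.
by move=> Hf; rewrite sqr_sqrtr //; have := ip_ge0 hH Hf; rewrite lecE => /andP[].
Qed.

Lemma ip_self f : H f -> ip f f = (nrm f ^+ 2)%:C%C.
Proof.
move=> Hf; rewrite hnorm_sqr //; have := ip_ge0 hH Hf.
by rewrite lecE => /andP[/eqP /= e _]; move: e; case: (ip f f) => x y /= ->.
Qed.

Lemma hnorm_eq0 f : H f -> nrm f = 0 -> f = 0.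
Proof. by move=> Hf e; apply: (ip_eq0 hH) => //; rewrite ip_self // e expr0n. Qed.

Lemma hnormZ (a : R[i]) f : H f -> nrm (a *: f) = normc a * nrm f.
Proof.
move=> Hf; apply/eqP; rewrite -(eqrXn2 (n:=2)) ?mulr_ge0 ?normc_ge0 ?hnorm_ge0 //.
rewrite exprMn (hnorm_sqr (hilbertZ a Hf)) (ipZl _ Hf (hilbertZ a Hf)) ipZr // ip_self //.
by rewrite sqr_normcE; case: (a) => x y /=; apply/eqP; ring.
Qed.

Lemma hnormB f g : H f -> H g -> nrm (f - g) = nrm (g - f).
Proof.
move=> Hf Hg; rewrite -[f - g]opprB -[- (g - f)]scaleN1r (hnormZ _ (hilbertB Hg Hf)).
by rewrite (normcN 1) normc1 mul1r.
Qed.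

Lemma hnorm_parallelogram f g : H f -> H g ->
  nrm (f + g) ^+ 2 + nrm (f - g) ^+ 2 = 2 * nrm f ^+ 2 + 2 * nrm g ^+ 2.
Proof.
move=> Hf Hg; have HD := hilbertD Hf Hg; have HB := hilbertB Hf Hg.
rewrite !hnorm_sqr // ipDl // ipBl // !ipBr // !ipDr // ?(ReB, ReD).
ring.
Qed.

(** The parameter [t] stays free because two values are used: [1 / |g|^2] yields the Cauchy-Schwarz
    inequality, and [1 / (|g|^2 + 1)] yields orthogonality of the projection, including for a zero
    vector. *)
Lemma hnorm_sqrB_ip (t : R) f g : H f -> H g ->
  nrm (f - (t%:C%C * ip f g) *: g) ^+ 2 =
  nrm f ^+ 2 - t * (2 - t * nrm g ^+ 2) * normc (ip f g) ^+ 2.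
Proof.
move=> Hf Hg; have Hz := hilbertZ (t%:C%C * ip f g) Hg.
have HB := hilbertB Hf Hz.
rewrite hnorm_sqr // ipBl // !ipBr // !ipZl // !ipZr //.
rewrite !ip_self // (ip_herm hH Hf Hg) sqr_normcE.
by case: (ip f g) => x y /=; ring.
Qed.

Lemma cauchy_schwarz f g : H f -> H g -> normc (ip f g) <= nrm f * nrm g.
Proof.
move=> Hf Hg; have [g0|g0] := eqVneq (nrm g) 0.
  rewrite (hnorm_eq0 Hg g0) (ip_herm hH (hilbert0 hH) Hf) ip0l // normc_conj.
  by rewrite normc0 mulr_ge0 ?hnorm_ge0.
rewrite -ler_sqr ?nnegrE ?mulr_ge0 ?normc_ge0 ?hnorm_ge0 // exprMn.
have G0 : 0 < nrm g ^+ 2 by rewrite exprn_gt0 // lt_neqAle eq_sym g0 hnorm_ge0.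
have := sqr_ge0 (nrm (f - ((nrm g ^- 2)%:C%C * ip f g) *: g)).
rewrite hnorm_sqrB_ip // mulVf ?gt_eqF // (_ : 2 - 1 = 1); last by ring.
by rewrite mulr1 subr_ge0 ler_pdivrMl // mulrC.
Qed.

Lemma le0_of_cvg0 (x : R) (u : nat -> R) : (forall n, x <= u n) ->
  u n @[n --> \oo] --> (0 : R) -> x <= 0.
Proof.
move=> hu cu; rewrite -(cvg_lim (@Rhausdorff R) cu); apply: limr_ge.
  by apply/cvg_ex; exists 0.
exact: nearW.
Qed.

Lemma eq_of_cvg0 (a b : R[i]) (u : nat -> R) : (forall n, normc (a - b) <= u n) ->
  u n @[n --> \oo] --> (0 : R) -> a = b.
Proof. by move=> hu cu; apply: normc_eq0_le; exact: le0_of_cvg0 cu. Qed.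

(** The parallelogram law for [u k - f] and [u l - f] bounds [|u k - u l|^2] by twice the sum of
    their squared norms, each below [(e / 2)^2]. *)
Lemma hilbert_cvg_cauchy (u : nat -> V) f : (forall n, H (u n)) -> H f ->
  nrm (u n - f) @[n --> \oo] --> (0 : R) ->
  forall e : R, 0 < e -> exists n : nat, forall k l : nat,
    (n <= k)%N -> (n <= l)%N -> nrm (u k - u l) < e.
Proof.
move=> Hu Hf cu e e0.
have [n _ hn] := cvgr0_norm_lt _ cu (e / 2) (divr_gt0 e0 (ltr0Sn R 1)).
exists n => k l /hn /= hk /hn /= hl; have Hd j := hilbertB (Hu j) Hf.
rewrite -ltr_sqr ?nnegrE ?hnorm_ge0 ?(ltW e0) //.
have := hnorm_parallelogram (Hd k) (Hd l).
have -> : u k - f - (u l - f) = u k - u l by rewrite opprB addrA subrK.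
have sq j : `|nrm (u j - f)| < e / 2 -> nrm (u j - f) ^+ 2 < (e / 2) ^+ 2.
  by move=> hj; rewrite ltr_sqr ?nnegrE ?hnorm_ge0 ?divr_ge0 ?(ltW e0) // -[ltLHS]ger0_norm ?hnorm_ge0.
have := sqr_ge0 (nrm (u k - f + (u l - f))); move: (sq _ hk) (sq _ hl).
rewrite expr_div_n; move: (nrm _ ^+ 2) (nrm _ ^+ 2) (nrm _ ^+ 2) (nrm _ ^+ 2) => *; lra.
Qed.

(** * Orthogonal projection onto a closed subspace *)

Section ClosedSubspace.
Variable M : set V.
Hypothesis MH : M `<=` H.
Hypothesis M0 : M 0.
Hypothesis ML : forall (a : R[i]) f g, M f -> M g -> M (a *: f + g).
Hypothesis Mclosed : forall (u : nat -> V) f, (forall n, M (u n)) -> H f ->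
  nrm (u n - f) @[n --> \oo] --> (0 : R) -> M f.

(** The midpoint [m] of [u k] and [u l] is in [M], so [|f - m|^2 >= d], and the parallelogram law
    leaves [|u k - u l|^2 < 2 / (k + 1) + 2 / (l + 1)]. The rank [n] is chosen so that each inverse
    is below [e^2 / 4]. *)
Lemma minimizing_cauchy f (d : R) (u : nat -> V) : H f ->
  (forall m, M m -> d <= nrm (f - m) ^+ 2) -> (forall n, M (u n)) ->
  (forall n, nrm (f - u n) ^+ 2 < d + n.+1%:R^-1) ->
  forall e : R, 0 < e -> exists n : nat, forall k l : nat,
    (n <= k)%N -> (n <= l)%N -> nrm (u k - u l) < e.
Proof.
move=> Hf dM Mu du e e0.
have [n _ hn] := near_infty_natSinv_lt (PosNum (divr_gt0 (exprn_gt0 2 e0) (ltr0Sn R 3))).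
exists n => k l nk nl.
have Hu j := MH (Mu j).
have Hfu j : H (f - u j) := hilbertB Hf (Hu j).
rewrite -ltr_sqr ?nnegrE ?hnorm_ge0 ?(ltW e0) // hnormB //.
have := hnorm_parallelogram (Hfu k) (Hfu l).
have -> : f - u k - (f - u l) = u l - u k.
  by rewrite opprB addrC addrA subrK.
pose m := 2^-1%:C%C *: (u k + u l).
have Mm : M m.
  rewrite -[m]addr0; apply: ML => //.
  by rewrite -[u k]scale1r; apply: ML.
have -> : f - u k + (f - u l) = (2 : R)%:C%C *: (f - m).
  rewrite scalerBr scalerA -rmorphM divff // scale1r.
  have -> : (2 : R)%:C%C = 1 + 1 :> R[i] by simpc.
  by rewrite scalerDl scale1r opprD addrACA.
have Hfm : H (f - m) by apply/hilbertB/MH.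
rewrite hnormZ // exprMn sqr_normcE /= expr0n /= addr0.
have := dM _ Mm; have := du k; have := du l; move: nk nl => /hn /= nk /hn /= nl.
move: nk nl; rewrite !ltr_pdivlMr ?ltr0n //.
move: (k.+1%:R^-1) (l.+1%:R^-1) (nrm _ ^+ 2) (nrm (f - u k) ^+ 2) => *.
lra.
Qed.

(** [g] is the limit of a minimizing sequence [u]. Orthogonality is proved approximately for each
    [f - u n], with an error that tends to 0, and then passed to the limit. *)
Lemma closed_projection f : H f ->
  exists2 g, M g & forall m, M m -> ip (f - g) m = 0.
Proof.
move=> Hf.
pose E := [set nrm (f - m) ^+ 2 | m in M].
have Einf : has_inf E.
  split; first by exists (nrm (f - 0) ^+ 2), 0.
  by exists 0 => _ [m _ <-]; exact: sqr_ge0.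
have dM m : M m -> inf E <= nrm (f - m) ^+ 2.
  by move=> Mm; apply: ge_inf; [exact: Einf.2 | exists m].
have [u Mu du] : exists2 u : nat -> V, forall n, M (u n) &
    forall n, nrm (f - u n) ^+ 2 < inf E + n.+1%:R^-1.
  suff /choice[u hu] : forall n : nat, exists m, M m /\
      nrm (f - m) ^+ 2 < inf E + n.+1%:R^-1.
    by exists u => n; case: (hu n).
  move=> n; have n0 : 0 < n.+1%:R^-1 :> R by rewrite invr_gt0.
  by have [_ [m Mm <-] hm] := inf_adherent n0 Einf; exists m.
have [g Hg ug] := hilbert_complete hH (fun n => MH (Mu n))
  (minimizing_cauchy Hf dM Mu du).
exists g; first exact: Mclosed ug.
move=> m Mm; apply: eq0_normc; apply/eqP.
rewrite -(sqrf_eq0 (normc _)) eq_le sqr_ge0 andbT.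
set q := nrm m ^+ 2.
have q0 : 0 <= q := sqr_ge0 _.
have Hm := MH Mm.
have near_orth n : normc (ip (f - u n) m) ^+ 2 <= (q + 1) * n.+1%:R^-1.
  (* Moving [u n] by [t <f - u n, m> m] lowers the squared distance to [f] by [t (2 - t q) c]. This
     is at least [t c], since [t q = 1 - t], and at most [1 / (n + 1)], since [u n] is nearly
     optimal. *)
  pose t := (q + 1)^-1.
  have t0 : 0 < t by rewrite invr_gt0; lra.
  have tq : t * (q + 1) = 1 by rewrite mulVf // gt_eqF //; lra.
  have Hfu : H (f - u n) := hilbertB Hf (MH (Mu n)).
  have := dM (u n + (t%:C%C * ip (f - u n) m) *: m).
  rewrite opprD addrA hnorm_sqrB_ip // -/q [u n + _]addrC => /(_ (ML _ Mm (Mu n))).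
  have := du n; set c := normc _ ^+ 2; set i := _^-1 => h1 h2.
  have c0 : 0 <= c := sqr_ge0 _.
  have tq1 : t * q = 1 - t by lra.
  have tc : t * c <= i.
    have : t * (2 - t * q) * c = t * c + t * (t * c) by rewrite tq1; ring.
    have : 0 <= t * (t * c) := mulr_ge0 (ltW t0) (mulr_ge0 (ltW t0) c0).
    lra.
  have -> : c = (q + 1) * (t * c) by rewrite mulrA [_ * t]mulrC tq mul1r.
  by rewrite ler_wpM2l //; lra.
(* Split [f - g] as [(f - u n) + (u n - g)] and use [|x + y|^2 <= 2 |x|^2 + 2 |y|^2]. The first term
   is controlled by [near_orth], the second by Cauchy-Schwarz. *)
apply: (@le0_of_cvg0 _ (fun n => 2 * ((q + 1) * n.+1%:R^-1) +
    2 * (nrm (u n - g) ^+ 2 * q))).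
  move=> n; have Hu := MH (Mu n).
  have -> : f - g = (f - u n) + (u n - g) by rewrite addrA subrK.
  have [Hfu Hug] := (hilbertB Hf Hu, hilbertB Hu Hg).
  rewrite ipDl //; set x := ip (f - u n) m; set y := ip _ m.
  have hx : normc x ^+ 2 <= (q + 1) * n.+1%:R^-1 := near_orth n.
  have hy : normc y ^+ 2 <= nrm (u n - g) ^+ 2 * q.
    rewrite -exprMn ler_sqr ?nnegrE ?mulr_ge0 ?normc_ge0 ?hnorm_ge0 //.
    exact: cauchy_schwarz.
  have hxy : normc (x + y) ^+ 2 <= (normc x + normc y) ^+ 2.
    rewrite ler_sqr ?nnegrE ?addr_ge0 ?normc_ge0 //; exact: le_normcD.
  have := sqr_ge0 (normc x - normc y).
  move: hx hy hxy; rewrite sqrrD sqrrB; move: (_ * _^-1) (_ * q) => a b.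
  move: (normc x * normc y *+ 2) (normc x ^+ 2) (normc y ^+ 2) => p X Y.
  move: (normc _ ^+ 2) => Z; lra.
rewrite [X in _ --> X](_ : 0 = 2 * ((q + 1) * 0) + 2 * (0 ^+ 2 * q)); last by ring.
apply: cvgD; apply: cvgMr.
  by apply: cvgMr; exact: cvg_harmonic.
by apply: cvgMl; rewrite expr2; apply: cvgM.
Qed.

Lemma closed_subspace_total :
  (forall f, H f -> (forall m, M m -> ip f m = 0) -> f = 0) -> H `<=` M.
Proof.
move=> orth0 f Hf; have [g Mg fg] := closed_projection Hf.
suff /eqP : f - g = 0 by rewrite subr_eq0 => /eqP ->.
by apply: orth0 => //; exact/hilbertB/MH.
Qed.

End ClosedSubspace.
End HilbertFacts.

(** * The conjugation [J] and the Dirichlet kernels *)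

Section DirichletFacts.
Variables (R : realType) (N : nat).
Implicit Types (w z : unit_ball R N) (f g : ball_fun R N).
Local Notation K := (@dirichlet_kernel R N).
Local Notation J := (@conjJ R N).

Lemma Re_dotc_ball_lt1 z w : complex.Re (dotc (val z) (val w)) < 1.
Proof. exact: Re_dotc_lt1 (valP z) (valP w). Qed.

Lemma conj_ballK : involutive (@conj_ball R N).
Proof.
move=> z; apply: val_inj; rewrite !SubK -map_mx_comp.
by apply/matrixP => i j; rewrite !mxE /= conjcK.
Qed.

Lemma conjJK : involutive J.
Proof. by move=> f; apply/funext => z; rewrite /conjJ conj_ballK conjcK. Qed.

Lemma conjJ_linear (a : R[i]) f g : J (a *: f + g) = conjc a *: J f + J g.
Proof. by apply/funext => z; rewrite /conjJ !fctE rmorphD rmorphM. Qed.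

Lemma conjJB f g : J (f - g) = J f - J g.
Proof. by apply/funext => z; rewrite /conjJ !fctE rmorphB. Qed.

Lemma dirichlet_kernel_herm z w : K w z = conjc (K z w).
Proof.
rewrite /dirichlet_kernel clog_inv1B_conj -?dotc_herm //.
exact: Re_dotc_ball_lt1.
Qed.

Lemma conjJ_kernel w : J (K w) = K (conj_ball w).
Proof.
apply/funext => z; rewrite /conjJ /dirichlet_kernel SubK dotc_conj.
rewrite -clog_inv1B_conj ?conjcK //.
exact: Re_dotc_lt1 (valP z) (enorm_conj_lt1 w).
Qed.

Lemma composition_kernel_conj (phi : unit_ball R N -> unit_ball R N) :
  (forall w, composition_operator phi (K (conj_ball w)) =
             K (conj_ball (phi w))) <->
  forall z w, dotc (val (phi z)) (val (conj_ball w)) =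
              dotc (val z) (val (conj_ball (phi w))).
Proof.
split=> [h z w | h w].
  have /(congr1 (fun f : ball_fun R N => f z)) := h w.
  rewrite /composition_operator /dirichlet_kernel => /addrI /clog_inv1B_inj.
  by apply; exact: Re_dotc_ball_lt1.
by apply/funext => z; rewrite /composition_operator /dirichlet_kernel h.
Qed.

End DirichletFacts.

(** * Density of the kernels, antiunitarity of [J], and J-symmetry tested on kernels *)

Section DirichletSpace.
Variables (R : realType) (N : nat).
Variables (D : set (ball_fun R N)) (ip : ball_fun R N -> ball_fun R N -> R[i]).
Hypothesis hD : is_dirichlet_space D ip.
Local Notation nrm := (hnorm ip).
Local Notation K := (@dirichlet_kernel R N).
Local Notation J := (@conjJ R N).
Local Notation DK := (dirichlet_kernelP hD).
Let hH := dirichlet_hilbert hD.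

(** A function orthogonal to every kernel vanishes at every point by the reproducing property. The
    lemma serves as an induction principle: a property stable under linear combinations and norm
    limits need only be checked on kernels. *)
Lemma dirichlet_kernels_total (M : set (ball_fun R N)) : M `<=` D -> M 0 ->
  (forall (a : R[i]) f g, M f -> M g -> M (a *: f + g)) ->
  (forall (u : nat -> ball_fun R N) f, (forall n, M (u n)) -> D f ->
    nrm (u n - f) @[n --> \oo] --> (0 : R) -> M f) ->
  (forall w, M (K w)) -> D `<=` M.
Proof.
move=> MD M0 ML Mc MK; apply: (closed_subspace_total hH) => // f Df f0.
by apply/funext => w; rewrite (dirichlet_reproducing hD) // f0.
Qed.

Lemma dirichlet_eval_bound f w : D f -> normc (f w) <= nrm f * nrm (K w).
Proof.
move=> Df; rewrite (dirichlet_reproducing hD) //.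
by apply: (cauchy_schwarz hH) => //; exact: DK.
Qed.

(* The set [M] below consists of the functions for which the conclusion holds.
   The condition [D (J g)] makes [M] contain the kernels before [J] is known to
   preserve [D]. *)
Lemma conjJ_antiunitary f : D f ->
  D (J f) /\ forall g, D g -> D (J g) -> ip (J f) (J g) = conjc (ip f g).
Proof.
pose M := [set f | [/\ D f, D (J f) &
  forall g, D g -> D (J g) -> ip (J f) (J g) = conjc (ip f g)]].
suff DM : D `<=` M by move=> /DM[].
apply: dirichlet_kernels_total.
- by move=> h [].
- have J0 : J 0 = 0 by apply/funext => z; rewrite /conjJ conjc0.
  split; rewrite ?J0; [exact: hilbert0 hH | exact: hilbert0 hH|].
  by move=> g Dg DJg; rewrite !(ip0l hH) // conjc0.
- move=> a h k [Dh DJh ih] [Dk DJk ik].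
  split; first exact: (hilbertP hH).
    by rewrite conjJ_linear; exact: (hilbertP hH).
  move=> g Dg DJg; rewrite conjJ_linear !(ip_linear hH) // ih // ik //.
  by rewrite rmorphD rmorphM.
- move=> u h Mu Dh uh.
  have Du n : D (u n) by case: (Mu n).
  have DJu n : D (J (u n)) by case: (Mu n).
  (* [J] is isometric on these differences, so [J (u n)] is Cauchy and has a limit [g] in [D] by
     completeness. *)
  have nJ k l : nrm (J (u k) - J (u l)) = nrm (u k - u l).
    have Dd : D (u k - u l) by exact: (hilbertB hH).
    have DJd : D (J (u k - u l)) by rewrite conjJB; exact: (hilbertB hH).
    have iso n : ip (J (u n)) (J (u k - u l)) = conjc (ip (u n) (u k - u l)).
      by case: (Mu n) => _ _; apply.
    rewrite /hnorm -conjJB; congr (Num.sqrt _).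
    by rewrite {1}conjJB !(ipBl hH) // !iso -rmorphB Re_conjc.
  have cJ := hilbert_cvg_cauchy hH Du Dh uh.
  have [g Dg Jug] := hilbert_complete hH DJu (fun e e0 => let: ex_intro n hn := cJ e e0 in
    ex_intro _ n (fun k l nk nl => eq_ind_r (fun x => x < e) (hn k l nk nl) (nJ k l))).
  (* Membership of [J h] in [D] is still unknown, so the two functions are compared pointwise: norm
     convergence implies convergence of the values, taken at [conj_ball z] for [u n] and at [z] for
     [J (u n)]. *)
  have Jh : J h = g.
    apply/funext => z; apply: (@eq_of_cvg0 _ _ _ (fun n =>
      nrm (u n - h) * nrm (K (conj_ball z)) + nrm (J (u n) - g) * nrm (K z))).
      move=> n; have -> : J h z - g z =
          - conjc ((u n - h) (conj_ball z)) + (J (u n) - g) z.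
        by rewrite !fctE rmorphB /conjJ opprB subrKA.
      apply: le_trans (le_normcD _ _) _; rewrite normcN normc_conj.
      by rewrite lerD // dirichlet_eval_bound //; exact: (hilbertB hH).
    rewrite [X in _ --> X](_ : 0 = 0 * nrm (K (conj_ball z)) + 0 * nrm (K z)).
      by apply: cvgD; apply: cvgMl.
    by rewrite !mul0r addr0.
  split=> //; first by rewrite Jh.
  move=> k Dk DJk; rewrite Jh; apply: (@eq_of_cvg0 _ _ _ (fun n =>
    nrm (J (u n) - g) * nrm (J k) + nrm (u n - h) * nrm k)).
    move=> n; have -> : ip g (J k) - conjc (ip h k) =
        - ip (J (u n) - g) (J k) + conjc (ip (u n - h) k).
      have [_ _ iso] := Mu n.
      by rewrite !(ipBl hH) // iso // rmorphB opprB subrKA.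
    apply: le_trans (le_normcD _ _) _; rewrite normcN normc_conj.
    by apply: lerD; apply: (cauchy_schwarz hH) => //; exact: (hilbertB hH).
  rewrite [X in _ --> X](_ : 0 = 0 * nrm (J k) + 0 * nrm k).
    by apply: cvgD; apply: cvgMl.
  by rewrite !mul0r addr0.
- move=> w; split; [exact: DK | by rewrite conjJ_kernel; exact: DK|].
  (* By the reproducing property both sides equal [g w]. *)
  move=> g Dg DJg; rewrite conjJ_kernel.
  rewrite (ip_herm hH DJg (DK _)) -(dirichlet_reproducing hD) //.
  by rewrite (ip_herm hH Dg (DK _)) -(dirichlet_reproducing hD) // /conjJ conj_ballK.
Qed.

Lemma dirichlet_conjJ f : D f -> D (J f).
Proof. by move=> /conjJ_antiunitary[]. Qed.

Lemma hnorm_conjJ f : D f -> nrm (J f) = nrm f.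
Proof.
move=> Df; have [DJf iso] := conjJ_antiunitary Df.
by rewrite /hnorm iso // Re_conjc.
Qed.

Lemma conj_symmetric_kernelP (phi : unit_ball R N -> unit_ball R N) :
  bounded_operator D ip (composition_operator phi) ->
  conj_symmetric D ip J (composition_operator phi) <->
  forall w, composition_operator phi (K (conj_ball w)) =
            K (conj_ball (phi w)).
Proof.
set T := composition_operator phi => - [TD TL [C TC]].
split=> [[S [[SD _ _] TS] TJ] w | TK].
  (* Pointwise, [S K_w (z) = <S K_w, K_z>] is the conjugate of [<T K_z, K_w> = K_z (phi w)], that is
     [K_(phi w) (z)]. *)
  have SK : S (K w) = K (phi w).
    apply/funext => z.
    rewrite (dirichlet_reproducing hD _ (SD _ (DK w))).
    rewrite (ip_herm hH (DK z) (SD _ (DK w))) -(TS _ _ (DK z) (DK w)).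
    by rewrite -(dirichlet_reproducing hD _ (TD _ (DK z))) -dirichlet_kernel_herm.
  by rewrite -!conjJ_kernel (TJ _ (DK w)) SK.
have TB f g : T (f - g) = T f - T g by apply/funext.
(* Since [J] is an involution, the relation [T J = J S] forces this candidate. The two conjugations
   cancel, so [S] is linear. *)
pose S f := J (T (J f)).
have SD f : D f -> D (S f) by move=> Df; apply/dirichlet_conjJ/TD/dirichlet_conjJ.
have SL (a : R[i]) f g : S (a *: f + g) = a *: S f + S g.
  by rewrite /S conjJ_linear -[T _]/(conjc a *: T (J f) + T (J g))
             conjJ_linear conjcK.
have SC f : D f -> nrm (S f) <= C * nrm f.
  move=> Df; have DJf := dirichlet_conjJ Df.
  by rewrite (hnorm_conjJ (TD _ DJf)) -(hnorm_conjJ Df) TC.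
have SK w : S (K w) = K (phi w) by rewrite /S conjJ_kernel TK conjJ_kernel conj_ballK.
exists S; last by move=> f Df; rewrite /S conjJK.
split; first by split=> //; exists C.
move=> f g Df Dg.
(* With [f] fixed, the adjoint identity is propagated in [g] from the kernels, where both sides are
   [f (phi w)]. Boundedness of [S] makes it pass to limits. *)
pose M := [set g | D g /\ ip (T f) g = ip f (S g)].
suff : M g by case.
apply: dirichlet_kernels_total Dg; first by move=> ? [].
- have := SL (-1) 0 0; rewrite scaleN1r addr0 oppr0 scaleN1r addNr => S0.
  have D0 := hilbert0 hH.
  split=> //; rewrite S0 -(scale0r 0) !(ipZr hH) // ?conjc0 ?mul0r //.
  exact: TD.
- move=> a h k [Dh eh] [Dk ek]; split; first exact: (hilbertP hH).
  have DZ h' : D h' -> D (a *: h') by exact: (hilbertZ hH).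
  by rewrite SL !(ipDr hH) ?(ipZr hH) ?eh ?ek //; do ?[exact: TD|exact: SD|apply: DZ].
- move=> u h Mu Dh uh; split=> //.
  apply: (@eq_of_cvg0 _ _ _ (fun n =>
    nrm (T f) * nrm (u n - h) + nrm f * (C * nrm (u n - h)))).
    move=> n; have [Du eu] := Mu n; have Dd : D (u n - h) by exact: (hilbertB hH).
    have SB : S (u n - h) = S (u n) - S h.
      by rewrite addrC -scaleN1r SL scaleN1r addrC.
    have -> : ip (T f) h - ip f (S h) =
        - ip (T f) (u n - h) + ip f (S (u n - h)).
      rewrite SB !(ipBr hH) ?eu ?opprB ?subrKA //; do ?[exact: TD|exact: SD].
    apply: le_trans (le_normcD _ _) _; rewrite normcN.
    apply: lerD; first by apply: (cauchy_schwarz hH) => //; exact: TD.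
    apply: le_trans (cauchy_schwarz hH Df (SD _ Dd)) _.
    by rewrite ler_wpM2l ?hnorm_ge0 // SC.
  rewrite [X in _ --> X](_ : 0 = nrm (T f) * 0 + nrm f * (C * 0)).
    by apply: cvgD; [apply: cvgMr | apply: cvgMr; apply: cvgMr].
  by rewrite !mulr0 addr0.
- move=> w; split; first exact: DK.
  by rewrite SK -!(dirichlet_reproducing hD) //; exact: TD.
Qed.

End DirichletSpace.

(** * Symbols that are restrictions of symmetric matrices *)

Section LinearSymbol.
Variables (R : realType) (N : nat).

(** For [|h| < 1] the point [h e_j] stays in the ball, where the extension by 0 agrees with [A]. The
    difference quotient is therefore constant near 0. *)
Lemma jacobian0_linear (phi : unit_ball R N -> unit_ball R N) (A : 'M[R[i]]_N) :
  (forall z, val (phi z) = A *m val z) -> jacobian0 phi = A.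
Proof.
move=> phiA.
have extA (z : 'cV[R[i]]_N) : enorm z < 1 ->
    extend (fun z : unit_ball R N => val (phi z)) z = A *m z.
  by move=> z1; rewrite /extend insubT /= phiA SubK.
apply/matrixP => i j; rewrite mxE.
suff -> : 'D_(delta_mx j 0) (extend (fun z : unit_ball R N => val (phi z)))
    (0 : 'cV[R[i]]_N) = A *m delta_mx j 0 by rewrite -colE mxE.
rewrite /derive; apply: norm_lim_near_cst.
near=> h; rewrite /= addr0 !extA ?mulmx0 ?subr0.
- rewrite -scalemxAr scalerA mulVf ?scale1r //.
  near: h; exact: nbhs_dnbhs_neq.
- by rewrite -(scale0r 0) enormZ normc0 mul0r.
- rewrite enormZ enorm_delta mulr1 -ltcR.
  near: h; exact: dnbhs0_lt.
Unshelve. all: by end_near.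
Qed.

Lemma symmetric_symbolP (phi : unit_ball R N -> unit_ball R N) :
  (forall z w, dotc (val (phi z)) (val (conj_ball w)) =
               dotc (val z) (val (conj_ball (phi w)))) <->
  exists2 A : 'M[R[i]]_N, A^T = A & forall z, val (phi z) = A *m val z.
Proof.
split=> [h | [A At phiA] z w]; last first.
  by rewrite !SubK !dotcE !phiA trmx_mul At mulmxA.
have {}h z w : ((val (phi z))^T *m val w) 0 0 = ((val z)^T *m val (phi w)) 0 0.
  by rewrite -!dotcE; exact: h.
(* Basis vectors lie on the unit sphere, outside the domain of [phi], so they are halved. The factor
   2 in [A] compensates. *)
have half_lt1 j : enorm (2^-1 *: (delta_mx j 0 : 'cV[R[i]]_N)) < 1.
  rewrite enormZ enorm_delta mulr1 normcV.
  have -> : normc (2 : R[i]) = 2.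
    by rewrite -[2 : R[i]]/(1 *+ 2) normcMn normc1.
  by rewrite invf_lt1 // ltr1n.
pose e j : unit_ball R N := Sub (2^-1 *: delta_mx j 0) (half_lt1 j).
pose A : 'M[R[i]]_N := \matrix_(i, j) (2 * val (phi (e i)) j 0).
(* Taking [w = e i] in the bilinear identity isolates half of coordinate [i] of [phi z] and equates
   it with [z^T phi (e i)], a linear form in [z]. *)
have phiA z : val (phi z) = A *m val z.
  apply/colP => i; have := h z (e i).
  rewrite SubK -scalemxAr mxE -colE !mxE => /(canRL (mulVKf _)) -> //.
  rewrite mulr_sumr; apply: eq_bigr => j _; rewrite !mxE; ring.
(* Row [j] of [A] is [2 phi (e j)] by definition, and [phiA] at [e j] identifies the same vector
   with column [j]. *)
exists A => //; apply/matrixP => i j.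
rewrite mxE [LHS]mxE phiA SubK -scalemxAr -colE !mxE mulrA divff ?mul1r //.
Qed.

End LinearSymbol.

Theorem corollary3p5 (R : realType) (N : nat) (hN : (0 < N)%N)
    (D : set (ball_fun R N)) (ip : ball_fun R N -> ball_fun R N -> R[i])
    (hD : is_dirichlet_space D ip)
    (phi : unit_ball R N -> unit_ball R N)
    (phi_holo : holomorphic (fun z => val (phi z)))
    (phi_bounded : bounded_operator D ip (composition_operator phi)) :
  conj_symmetric D ip (@conjJ R N) (composition_operator phi) <->
  [/\ forall z : unit_ball R N, val (phi z) = jacobian0 phi *m val z,
      (jacobian0 phi)^T = jacobian0 phi
    & opnorm (jacobian0 phi) <= 1].
Proof.
rewrite (conj_symmetric_kernelP hD phi_bounded) composition_kernel_conj.
rewrite symmetric_symbolP; split=> [[A At phiA] | [phiA At _]]; last first.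
  by exists (jacobian0 phi).
(* The norm bound holds because [phi], and hence [A], maps the open ball into itself. *)
rewrite (jacobian0_linear phiA); split=> //; apply: opnorm_le1 => z z1.
by have := valP (phi (Sub z z1)); rewrite /= phiA SubK.
Qed.
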